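(* There is a probability law $G$ on $(0,\infty)$ for which $W_n^\downarrow$ does not converge in distribution (as $n\to\infty$) even in the product topology, whereas, for standard symmetric Cauchy marks $X_1,X_2,\ldots$, $$\sum_{i=1}^nW_{n,i}X_i\overset{d}{=}X_1\qquad\text{for every }n\ge1.$$
   Context: $Y_1,Y_2,\ldots$ are iid with law $G$, $S_n=\sum_{i=1}^nY_i$, $W_{n,i}=Y_i/S_n$ for $1\le i\le n$, and $W_n^\downarrow$ is the decreasing rearrangement of $(W_{n,i})_{i\le n}$ with zeros appended, viewed as a random element of $\{q_1\ge q_2\ge\cdots\ge0:\sum_jq_j\le1\}$ with the product topology (coordinatewise convergence). The marks $X_1,X_2,\ldots$ are iid and independent of $(Y_i)$. *)

(* Defs.v *)
From HB Require Import structures.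
From mathcomp Require Import all_boot all_order all_algebra.
From mathcomp Require Import all_classical all_reals all_analysis.
From mathcomp Require Import measurable_realfun.

Set Implicit Arguments.
Unset Strict Implicit.
Unset Printing Implicit Defensive.

Import Order.TTheory GRing.Theory Num.Theory.
Import numFieldNormedType.Exports.

Local Open Scope classical_set_scope.
Local Open Scope ring_scope.

(* Throughout, sequences are indexed from 0: [X 0], [X 1], ... stand for
   X_1, X_2, ... *)

Section laws.
Context d (T : measurableType d) (R : realType) (P : probability T R).

Definition has_law d' (T' : measurableType d') (X : T -> T')
    (mu : probability T' R) :=
  forall B, measurable B -> P (X @^-1` B) = mu B.

Definition same_law d' (T' : measurableType d') (X Y : T -> T') :=
  forall B, measurable B -> P (X @^-1` B) = P (Y @^-1` B).

Definition mutually_independent d' (T' : measurableType d')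
    (X : nat -> {RV P >-> T'}) :=
  forall (J : seq nat) (B : nat -> set T'), uniq J ->
    (forall i, measurable (B i)) ->
    P (\bigcap_(i in [set` J]) (X i @^-1` B i)) =
    (\prod_(i <- J) P (X i @^-1` B i))%E.

Definition iid d' (T' : measurableType d') (X : nat -> {RV P >-> T'})
    (mu : probability T' R) :=
  mutually_independent X /\ forall i, has_law (X i) mu.

Definition sigma_of d' (T' : measurableType d') (X : nat -> {RV P >-> T'}) :
    set (set T) :=
  <<s \bigcup_i preimage_set_system setT (X i) measurable >>.

Definition independent_families d1 (T1 : measurableType d1)
    d2 (T2 : measurableType d2)
    (X : nat -> {RV P >-> T1}) (Y : nat -> {RV P >-> T2}) :=
  forall A B, sigma_of X A -> sigma_of Y B ->
    P (A `&` B) = (P A * P B)%E.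

End laws.

Notation borel S := (g_sigma_algebraType (@open S)).

Definition converges_in_distribution d (T : measurableType d) (R : realType)
    (P : probability T R) (S : ptopologicalType) (Z : nat -> T -> S)
    (mu : probability (borel S) R) :=
  forall f : S -> R, continuous f -> bounded_fun f ->
    ('E_P[f \o Z n] @[n --> \oo] --> 'E_mu[f])%E.

Section simplex.
Context {R : realType}.

Definition is_ranked_mass : set {ptws nat -> R} :=
  [set q | [/\ forall j, q j.+1 <= q j, forall j, 0 <= q j &
               (\sum_(0 <= j <oo) (q j)%:E <= 1)%E]].

Lemma is_ranked_mass0 : is_ranked_mass (fun=> 0).
Proof. by split => //; rewrite eseries0. Qed.

(* The library's topology on the subtype [set_type is_ranked_mass] is the one
   induced by the product topology of [{ptws nat -> R}]. *)
Definition ranked_simplex : Type := is_ranked_mass.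
HB.instance Definition _ :=
  Topological.copy ranked_simplex (set_type is_ranked_mass).
HB.instance Definition _ :=
  isPointed.Build ranked_simplex (SigSub (mem_set is_ranked_mass0)).

Definition weight (y : nat -> R) (n i : nat) : R := y i / \sum_(k < n) y k.

Definition ranked_weight (y : nat -> R) (n : nat) : {ptws nat -> R} :=
  fun j => nth 0 (sort (fun a b => b <= a) [seq weight y n i | i <- iota 0 n]) j.

(* Random variables with a law carried by ]0, +oo[ are positive only almost
   surely. On that event the value is [ranked_weight] by [val_ranked_weights];
   off it, [ranked_weight] is replaced by 0 when it leaves the simplex. *)
Definition ranked_weights (y : nat -> R) (n : nat) : ranked_simplex :=
  insubd (point : ranked_simplex) (ranked_weight y n).

Lemma ranked_weight_mass y n :
  (forall i, (i < n)%N -> 0 < y i) -> is_ranked_mass (ranked_weight y n).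
Proof.
move=> y0; rewrite /ranked_weight; set s := [seq _ | _ <- _].
set t := sort _ s.
have S0 : 0 <= \sum_(k < n) y k by apply: sumr_ge0 => k _; apply/ltW/y0.
have tge0 x : x \in t -> 0 <= x.
  rewrite mem_sort => /mapP[i]; rewrite mem_iota add0n => /andP[_ i_n] ->.
  by rewrite /weight divr_ge0 // ltW // y0.
have t0 j : 0 <= nth 0 t j.
  have [jt|jt] := ltnP j (size t); first by apply/tge0/mem_nth.
  by rewrite nth_default.
have tn : size t = n by rewrite size_sort size_map size_iota.
split => //.
- move=> j; have [jt|jt] := ltnP j.+1 (size t); last by rewrite nth_default.
  have st : sorted (fun a b : R => b <= a) t.
    by apply: sort_sorted => a b; exact: le_total.
  by have /(sortedP 0)/(_ _ jt) := st.
- rewrite (nneseries_split _ n); last by move=> k _; rewrite lee_fin.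
  rewrite add0n [X in (_ + X)%E]eseries0; last first.
    by move=> i ni _; rewrite nth_default // tn.
  rewrite adde0 sumEFin lee_fin -{1}tn -(big_nth 0 xpredT idfun) /=.
  rewrite (perm_big s) /=; last by rewrite perm_sort.
  rewrite big_map -{1}[n]subn0 big_mkord -mulr_suml.
  have [->|Sneq0] := eqVneq (\sum_(k < n) y k) 0; first by rewrite mul0r.
  by rewrite divff.
Qed.

Lemma val_ranked_weights y n :
  (forall i, (i < n)%N -> 0 < y i) ->
  val (ranked_weights y n) = ranked_weight y n.
Proof.
by move=> y0; rewrite val_insubd mem_set //; exact: ranked_weight_mass.
Qed.

End simplex.
Arguments ranked_simplex : clear implicits.

Section cauchy.
Context {R : realType}.
Local Notation mu := (@lebesgue_measure R).

Definition cauchy_pdf (x : R) : R := (pi * (1 + x ^+ 2))^-1.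

Definition cauchy_prob (V : set R) : \bar R :=
  (\int[mu]_(x in V) (cauchy_pdf x)%:E)%E.

Lemma cauchy_pdf_ge0 x : 0 <= cauchy_pdf x.
Proof. by rewrite invr_ge0 mulr_ge0 ?pi_ge0 // addr_ge0 ?sqr_ge0. Qed.

Lemma cauchy_pdfE : cauchy_pdf = (fun x => pi^-1 * (oneDsqr x)^-1).
Proof. by apply/funext => x; rewrite /cauchy_pdf invfM. Qed.

Lemma continuous_cauchy_pdf : continuous cauchy_pdf.
Proof.
rewrite cauchy_pdfE => x; apply: cvgM; first exact: cvg_cst.
exact: continuous_oneDsqrV.
Qed.

Lemma measurable_cauchy_pdf : measurable_fun [set: R] cauchy_pdf.
Proof.
by apply: continuous_measurable_fun; exact: continuous_cauchy_pdf.
Qed.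

Lemma integral_cauchy_pdf : (\int[mu]_x (cauchy_pdf x)%:E = 1)%E.
Proof.
rewrite ge0_symfun_integralT; last 3 first.
- exact: cauchy_pdf_ge0.
- exact: continuous_cauchy_pdf.
- by move=> x; rewrite /cauchy_pdf /= sqrrN.
rewrite -set_itvcy cauchy_pdfE.
under eq_integral do rewrite EFinM.
rewrite ge0_integralZl_EFin //=.
- rewrite integral0y_oneDsqr -!EFinM; congr EFin.
  by rewrite mulKf ?gt_eqF ?pi_gt0 // divff.
- apply/measurable_EFinP; apply: measurable_funTS.
  by apply: continuous_measurable_fun; exact: continuous_oneDsqrV.
- by rewrite invr_ge0 pi_ge0.
Qed.

Let cauchy0 : cauchy_prob set0 = 0%E.
Proof. by rewrite /cauchy_prob integral_set0. Qed.

Let cauchy_ge0 A : (0 <= cauchy_prob A)%E.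
Proof. by apply: integral_ge0 => x _; rewrite lee_fin cauchy_pdf_ge0. Qed.

Let cauchy_sigma_additive : semi_sigma_additive cauchy_prob.
Proof.
move=> F mF tF mUF; rewrite /cauchy_prob; apply: cvg_toP.
  apply: ereal_nondecreasing_is_cvgn => m n mn.
  apply: lee_sum_nneg_natr => // k _ _; apply: integral_ge0 => x _.
  by rewrite lee_fin cauchy_pdf_ge0.
rewrite ge0_integral_bigcup //=.
- apply/measurable_funTS/measurableT_comp => //.
  exact: measurable_cauchy_pdf.
- by move=> x _; rewrite lee_fin cauchy_pdf_ge0.
Qed.

HB.instance Definition _ := isMeasure.Build _ _ _ cauchy_prob
  cauchy0 cauchy_ge0 cauchy_sigma_additive.

HB.instance Definition _ := Measure_isProbability.Build _ _ _
  cauchy_prob integral_cauchy_pdf.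

End cauchy.

(* Main.v *)
(* The law G is carried by the points a_k = q ^ (k ^ 2), with
   G [a_k, +oo[ = q ^ - k for a large even integer q.  When n = q ^ (k + 1) / 2,
   with probability at least 1/4 exactly one of Y_1, ..., Y_n is at least
   a_(k+1); it then dominates the sum of the others, so the largest weight has
   mean at least 1/8.  When n = N ^ 3 * q ^ k with N = 32, except on an event of
   probability at most 2/N no Y_i exceeds a_k and each of N blocks of indices
   contains a value a_k, so the largest weight is at most 1/N and its mean is at
   most 3/N < 1/8.  Since the first coordinate is a bounded continuous function
   on the simplex, there is no limit law.

   For the marks, conditionally on the (countably many) values of Y_1, ..., Y_n
   the weights are positive constants of sum 1, and the Cauchy law is strictly
   stable; stability is obtained by convolving densities, with the help of
   partial fractions. *)

From HB Require Import structures.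
Require Import Defs.
From mathcomp Require Import all_boot all_order all_algebra.
From mathcomp Require Import all_classical all_reals all_analysis.
From mathcomp Require Import measurable_realfun ring lra zify.

Import Order.TTheory GRing.Theory Num.Theory.
Import numFieldNormedType.Exports.

Local Open Scope classical_set_scope.
Local Open Scope ring_scope.

(** * Stability of the Cauchy law *)

Section improper_integrals.
Context {R : realType}.
Local Notation mu := (@lebesgue_measure R).

Lemma ge0_integral_antiderivativey (f F : R -> R) (a l : R) :
  (forall x, 0 <= f x) -> continuous f ->
  (forall x : R, is_derive x 1 F (f x)) -> F x @[x --> +oo] --> l ->
  (\int[mu]_(x in `[a, +oo[) (f x)%:E = (l - F a)%:E)%E.
Proof.
move=> f0 cf dF Fl.
have cF : continuous F.
  move=> x; apply/differentiable_continuous/derivable1_diffP.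
  by have [] := dF x.
rewrite (@ge0_continuous_FTC2y _ f F a l) //.
- exact: continuous_subspaceT.
- by apply: cvg_at_right_filter; exact: cF.
- by move=> x _; rewrite derive1E; have [] := dF x.
Qed.

Lemma ge0_integral_antiderivativeT (f F : R -> R) (l l' : R) :
  (forall x, 0 <= f x) -> continuous f ->
  (forall x : R, is_derive x 1 F (f x)) ->
  F x @[x --> +oo] --> l -> F x @[x --> -oo] --> l' ->
  (\int[mu]_x (f x)%:E = (l - l')%:E)%E.
Proof.
move=> f0 cf dF Fl Fl'.
have mf : measurable_fun setT f by exact: continuous_measurable_fun.
rewrite -(setUv [set` `]-oo, 0%R]]) ge0_integral_setU //=; first last.
- exact/disj_setPCl.
- by move=> x _; rewrite lee_fin.
- by rewrite setUv; exact/measurable_EFinP.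
- exact: measurableC.
rewrite setCitvl.
rewrite integral_itv_obnd_cbnd; last exact/measurable_EFinP/measurable_funTS.
rewrite (ge0_integral_antiderivativey f F 0 l) //.
have := @ge0_integration_by_substitutionNy R f 0.
rewrite oppr0 => -> //; last exact: continuous_subspaceT.
have -> : (\int[mu]_(x in `[0%R, +oo[) ((f \o -%R) x)%:E = (F 0 - l')%:E)%E.
  (* Reflection turns the left half-line into the right one: [- F (- x)] is an antiderivative of
     [f (- x)] and tends to [- l'] at +oo. *)
  have -> : F 0 - l' = - l' - (- F (- 0)) by rewrite oppr0; lra.
  apply: (ge0_integral_antiderivativey _ (fun x => - F (- x))).
  - by move=> x; exact: f0.
  - by move=> x; apply: continuous_comp; [exact: opp_continuous|exact: cf].
  - move=> x; have H := is_derive1_comp (dF (- x)) (@is_deriveNid R R x 1).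
    by have := is_deriveN H; rewrite /= mulrN1 opprK.
  - by apply: cvgN; apply/cvgy_compNP; under eq_fun do rewrite /= opprK.
by rewrite -EFinD; congr EFin; lra.
Qed.

End improper_integrals.

(** * Convolution of two Cauchy densities *)

Section cauchy_convolution.
Context {R : realType}.
Local Notation mu := (@lebesgue_measure R).
Local Notation kappa := (@cauchy_prob R).

Lemma cvgNy_atan : @atan R x @[x --> -oo] --> - (pi / 2).
Proof.
apply/cvgNy_compNP; rewrite (_ : _ \o _ = (fun x => - @atan R x)).
  by apply: cvgN; exact: cvgy_atan.
by apply/funext => x /=; rewrite atanN.
Qed.

Lemma is_derive_atan_affine (s u c x : R) : c != 0 ->
  is_derive x 1 (fun x => atan ((s * x - u) / c))
    (s * c / (c ^+ 2 + (s * x - u) ^+ 2)).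
Proof.
move=> c0.
have H : is_derive x 1 (fun x : R => (s * x - u) / c) (s / c).
  by apply: is_derive_eq; rewrite /GRing.scale /=; field.
have K := @is_derive1_comp R atan (fun x => (s * x - u) / c) x _ _
  (is_derive1_atan ((s * x - u) / c)) H.
apply: is_derive_eq K _.
have D0 : c ^+ 2 + (s * x - u) ^+ 2 != 0.
  by rewrite gt_eqF // ltr_wpDr ?sqr_ge0 // exprn_even_gt0.
have E : 1 + ((s * x - u) / c) ^+ 2 = (c ^+ 2 + (s * x - u) ^+ 2) / c ^+ 2.
  by field.
by rewrite E; field; rewrite c0 D0.
Qed.

Lemma cvgy_atan_affine (s u c : R) : 0 < s -> 0 < c ->
  atan ((s * x - u) / c) @[x --> +oo] --> pi / 2.
Proof.
move=> s0 c0.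
apply: (@cvg_comp _ _ _ (fun x => (s * x - u) / c) atan); last exact: cvgy_atan.
apply/cvgryPge => A; near=> x.
rewrite ler_pdivlMr // lerBrDr -ler_pdivrMl //.
Unshelve. all: end_near. Qed.

Lemma cvgNy_atan_affine (s u c : R) : 0 < s -> 0 < c ->
  atan ((s * x - u) / c) @[x --> -oo] --> - (pi / 2).
Proof.
move=> s0 c0.
apply: (@cvg_comp _ _ _ (fun x => (s * x - u) / c) atan); last exact: cvgNy_atan.
apply/cvgrNyPle => A; near=> x.
rewrite ler_pdivrMr // lerBlDr -ler_pdivlMl //.
Unshelve. all: end_near. Qed.

(** Density at [x] of [u + c * X] for a standard Cauchy variable [X]: location [u], scale [c]. *)
Definition cauchy_density (c u x : R) : R :=
  c / (pi * (c ^+ 2 + (x - u) ^+ 2)).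

Lemma cauchy_density_den_gt0 (c y : R) : 0 < c -> 0 < c ^+ 2 + y ^+ 2.
Proof. by move=> c0; rewrite ltr_wpDr ?sqr_ge0 // exprn_gt0. Qed.

Lemma cauchy_density_ge0 (c u x : R) : 0 < c -> 0 <= cauchy_density c u x.
Proof.
move=> c0; apply: divr_ge0; first exact: ltW.
by apply: mulr_ge0; [exact: pi_ge0|apply: ltW; exact: cauchy_density_den_gt0].
Qed.

Lemma continuous_cauchy_density_affine (c s u : R) : 0 < c ->
  continuous (fun x => cauchy_density c u (s * x)).
Proof.
move=> c0 x; apply: cvgM; first exact: cvg_cst.
apply: cvgV.
  by rewrite mulf_neq0 // gt_eqF // ?pi_gt0 // cauchy_density_den_gt0.
apply: cvgM; first exact: cvg_cst.
apply: cvgD; first exact: cvg_cst.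
apply: (@cvg_comp _ _ _ (fun x => s * x - u) (fun y => y ^+ 2)).
  by apply: cvgB; [apply: cvgM; [exact: cvg_cst|exact: cvg_id]|exact: cvg_cst].
exact: exprn_continuous.
Qed.

Lemma continuous_cauchy_density (c u : R) : 0 < c ->
  continuous (cauchy_density c u).
Proof.
move=> c0; have := @continuous_cauchy_density_affine c 1 u c0.
by under eq_fun do rewrite mul1r.
Qed.

Lemma integral_cauchy_densityy (c u z : R) : 0 < c ->
  (\int[mu]_(x in `[z, +oo[) (cauchy_density c u x)%:E =
    (2^-1 - pi^-1 * atan ((z - u) / c))%:E)%E.
Proof.
move=> c0; have pi_neq0 : pi != 0 :> R by rewrite gt_eqF // pi_gt0.
apply: (ge0_integral_antiderivativey _ (fun x => pi^-1 * atan ((x - u) / c))).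
- by move=> x; exact: cauchy_density_ge0.
- exact: continuous_cauchy_density.
- move=> x; have := @is_derive_atan_affine 1 u c x (lt0r_neq0 c0).
  under eq_fun do rewrite mul1r; rewrite !mul1r => H.
  apply: is_derive_eq (is_deriveZ pi^-1 H) _.
  by rewrite /GRing.scale /= /cauchy_density invfM mulrCA.
- rewrite (_ : 2^-1 = pi^-1 * (pi / 2) :> R); last first.
    by move: (pi : R) pi_neq0 => p p0; field.
  apply: cvgM; first exact: cvg_cst.
  have := @cvgy_atan_affine 1 u c ltr01 c0.
  by under eq_fun do rewrite mul1r.
Qed.

(** Both logarithms diverge, so they are merged into minus the logarithm of a ratio of quadratics.
    In the variable [t = x^-1] this ratio extends continuously to [t = 0], with value [s ^+ 2]. *)
Lemma cvgy_ln_quadratic_ratio (s u c : R) : 0 < s -> 0 < c ->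
  ln (1 + x ^+ 2) - ln (c ^+ 2 + (s * x - u) ^+ 2) @[x --> +oo]
    --> - ln (s ^+ 2).
Proof.
move=> s0 c0.
pose h t : R := ln ((c ^+ 2 * t ^+ 2 + (s - u * t) ^+ 2) / (1 + t ^+ 2)).
have hx : {near +oo, (fun x => - h x^-1) =1
    (fun x => ln (1 + x ^+ 2) - ln (c ^+ 2 + (s * x - u) ^+ 2))}.
  near=> x; have x0 : 0 < x by [].
  rewrite /h -[RHS]opprB -ln_div ?posrE ?cauchy_density_den_gt0 //; last first.
    by rewrite ltr_wpDr ?sqr_ge0.
  congr (- ln _); field.
  by rewrite !gt_eqF // ltr_wpDr ?sqr_ge0.
apply: cvg_trans (near_eq_cvg hx) _.
have h0 : h 0 = ln (s ^+ 2).
  by rewrite /h mulr0 subr0 expr0n /= mulr0 add0r addr0 divr1.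
rewrite -h0; apply: cvgN.
apply: (@cvg_comp _ _ _ (fun x : R => x^-1) h).
  apply/gtr0_cvgV0; [|exact: cvg_id].
  by near=> x.
have sq t : {for t, continuous (fun y : R => y ^+ 2)} by exact: exprn_continuous.
rewrite h0; apply: (@cvg_comp _ _ _ _ (@ln R) _ (nbhs (s ^+ 2))); last first.
  by apply: continuous_ln; exact: exprn_gt0.
have E : s ^+ 2 = (c ^+ 2 * 0 ^+ 2 + (s - u * 0) ^+ 2) / (1 + 0 ^+ 2).
  by rewrite mulr0 subr0 expr0n /= mulr0 add0r addr0 divr1.
rewrite {1}E.
apply: cvgM; last first.
  apply: cvgV; first by rewrite expr0n /= addr0.
  by apply: cvgD; [exact: cvg_cst|exact: sq].
apply: cvgD; first by apply: cvgM; [exact: cvg_cst|exact: sq].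
apply: (@cvg_comp _ _ _ (fun x => s - u * x) (fun y => y ^+ 2)); last exact: sq.
apply: cvgB; first exact: cvg_cst.
by apply: cvgM; [exact: cvg_cst|exact: cvg_id].
Unshelve. all: end_near. Qed.

Lemma cvgNy_ln_quadratic_ratio (s u c : R) : 0 < s -> 0 < c ->
  ln (1 + x ^+ 2) - ln (c ^+ 2 + (s * x - u) ^+ 2) @[x --> -oo]
    --> - ln (s ^+ 2).
Proof.
move=> s0 c0; apply/cvgNy_compNP; have := @cvgy_ln_quadratic_ratio s (- u) c s0 c0.
rewrite (_ : _ \o _ = (fun x => ln (1 + x ^+ 2) - ln (c ^+ 2 + (s * x - - u) ^+ 2))) //.
apply/funext => x /=; congr (ln _ - ln _); ring.
Qed.

(* [al * 'i + be] is the value at the pole [x = 'i] of the inverse of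
   [c ^+ 2 + (s * x - u) ^+ 2], whose squared modulus there is [Q]. *)
Lemma partial_fractions (s c u x : R) :
  let Q := ((s + c) ^+ 2 + u ^+ 2) * ((s - c) ^+ 2 + u ^+ 2) in
  let al := 2 * s * u / Q in
  let be := (c ^+ 2 + u ^+ 2 - s ^+ 2) / Q in
  let K := 1 - be * (c ^+ 2 + u ^+ 2) - al * s * u in
  Q != 0 ->
  (al * x + be) * (c ^+ 2 + (s * x - u) ^+ 2) +
    (K - al * s * (s * x - u)) * (1 + x ^+ 2) = 1.
Proof.
move=> Q al be K Q0.
(* [h1] and [h2] are the real and imaginary parts of the statement that [al * 'i + be] times [c ^+ 2
   + u ^+ 2 - s ^+ 2 - 2 * s * u * 'i] equals 1. *)
have h1 : be * (c ^+ 2 + u ^+ 2 - s ^+ 2) + 2 * s * u * al = 1.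
  rewrite -[RHS](divff Q0) {1}/Q /be /al; ring.
have h2 : al * (c ^+ 2 + u ^+ 2 - s ^+ 2) = 2 * s * u * be.
  by rewrite /be /al; ring.
rewrite (_ : (_ + _) = 1 + x ^+ 2 * (1 - (be * (c ^+ 2 + u ^+ 2 - s ^+ 2) + 2 * s * u * al))
  + x * (al * (c ^+ 2 + u ^+ 2 - s ^+ 2) - 2 * s * u * be)).
  by rewrite h1 h2 !subrr !mulr0 !addr0.
by rewrite /K; ring.
Qed.

(** The integral is the density at [u] of [s * X + c * Y], with [X] and [Y] independent standard
    Cauchy. Partial fractions give an explicit antiderivative. With [u != 0] the poles of the two
    factors differ even when [s = c], so [Q] does not vanish. *)
Lemma cauchy_density_convolution (s c u : R) : 0 < s -> 0 < c -> u != 0 ->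
  (\int[mu]_x (cauchy_density c u (s * x) * cauchy_pdf x)%:E =
    (cauchy_density (s + c) 0 u)%:E)%E.
Proof.
move=> s0 c0 u0.
have pi_neq0 : pi != 0 :> R by rewrite gt_eqF // pi_gt0.
pose Q : R := ((s + c) ^+ 2 + u ^+ 2) * ((s - c) ^+ 2 + u ^+ 2).
have Q1 : (s + c) ^+ 2 + u ^+ 2 != 0.
  by rewrite gt_eqF // ltr_wpDl ?sqr_ge0 // exprn_even_gt0.
have Q2 : (s - c) ^+ 2 + u ^+ 2 != 0.
  by rewrite gt_eqF // ltr_wpDl ?sqr_ge0 // exprn_even_gt0.
pose al := 2 * s * u / Q.
pose be := (c ^+ 2 + u ^+ 2 - s ^+ 2) / Q.
pose K := 1 - be * (c ^+ 2 + u ^+ 2) - al * s * u.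
pose F x := c / pi ^+ 2 * (al / 2 * (ln (1 + x ^+ 2) - ln (c ^+ 2 + (s * x - u) ^+ 2))
   + be * atan x + K / (s * c) * atan ((s * x - u) / c)).
(* The limits of [F] are [l (pi / 2)] at +oo and [l (- (pi / 2))] at -oo. The logarithmic part has
   the same limit at both ends and cancels in the difference. *)
pose l e : R := c / pi ^+ 2 * (al / 2 * (- ln (s ^+ 2)) + be * e + K / (s * c) * e).
have <- : l (pi / 2) - l (- (pi / 2)) = cauchy_density (s + c) 0 u.
  rewrite /l /cauchy_density /K /al /be /Q subr0.
  move: (pi : R) pi_neq0 => p p0; field.
  by rewrite Q1 Q2 p0 !gt_eqF.
have FTC := ge0_integral_antiderivativeT
  (fun x => cauchy_density c u (s * x) * cauchy_pdf x) F (l (pi / 2)) (l (- (pi / 2))).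
apply: FTC.
- by move=> x; rewrite mulr_ge0 ?cauchy_density_ge0 ?cauchy_pdf_ge0.
- move=> x; apply: cvgM; first exact: continuous_cauchy_density_affine.
  exact: continuous_cauchy_pdf.
- move=> x.
  have N0 : 0 < 1 + x ^+ 2 by rewrite ltr_wpDr ?sqr_ge0.
  have D0 := cauchy_density_den_gt0 _ (s * x - u) c0.
  have H1 : is_derive x 1 (fun x : R => ln (1 + x ^+ 2)) (2 * x / (1 + x ^+ 2)).
    have H : is_derive x 1 (fun x : R => 1 + x ^+ 2) (2 * x).
      by apply: is_derive_eq; rewrite /GRing.scale /=; ring.
    have := @is_derive1_comp R (@ln R) (fun x => 1 + x ^+ 2) x _ _ (is_derive1_ln N0) H.
    by move/is_derive_eq; apply; rewrite mulrC.
  have H2 : is_derive x 1 (fun x : R => ln (c ^+ 2 + (s * x - u) ^+ 2))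
      (2 * s * (s * x - u) / (c ^+ 2 + (s * x - u) ^+ 2)).
    have H : is_derive x 1 (fun x : R => c ^+ 2 + (s * x - u) ^+ 2)
        (2 * s * (s * x - u)).
      by apply: is_derive_eq; rewrite /GRing.scale /=; ring.
    have := @is_derive1_comp R (@ln R) (fun x => c ^+ 2 + (s * x - u) ^+ 2) x _ _
      (is_derive1_ln D0) H.
    by move/is_derive_eq; apply; rewrite mulrC.
  have H3 := is_derive_atan_affine s u c x (lt0r_neq0 c0).
  rewrite /F; apply: is_derive_eq; rewrite /GRing.scale /=.
  have := partial_fractions s c u x; rewrite /= -/Q -/al -/be -/K => PF.
  move: PF (gt_eqF N0) (gt_eqF D0).
  rewrite /cauchy_density /cauchy_pdf.
  set D := c ^+ 2 + _; set N := 1 + _.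
  move=> PF /negbT N1 /negbT D1.
  (* Over the common denominator [D * N] the numerator becomes the left side of [partial_fractions],
     that is 1. *)
  transitivity (c / pi ^+ 2 *
    (((al * x + be) * D + (K - al * s * (s * x - u)) * N) / (D * N))).
    congr (_ * _); move: al be K D N D1 N1 {PF F l H1 H2 H3 N0 D0} => al be K D N D1 N1.
    by field; rewrite D1 N1 !gt_eqF.
  rewrite PF ?mulf_neq0 //.
  move: (pi : R) pi_neq0 D N D1 N1 {F l H1 H2 H3 PF N0 D0} => p p0 D N D1 N1.
  by field; rewrite D1 N1 p0.
- apply: cvgM; first exact: cvg_cst.
  apply: cvgD; last first.
    by apply: cvgM; [exact: cvg_cst|exact: cvgy_atan_affine].
  apply: cvgD; last by apply: cvgM; [exact: cvg_cst|exact: cvgy_atan].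
  by apply: cvgM; [exact: cvg_cst|exact: cvgy_ln_quadratic_ratio].
- apply: cvgM; first exact: cvg_cst.
  apply: cvgD; last first.
    by apply: cvgM; [exact: cvg_cst|exact: cvgNy_atan_affine].
  apply: cvgD; last by apply: cvgM; [exact: cvg_cst|exact: cvgNy_atan].
  by apply: cvgM; [exact: cvg_cst|exact: cvgNy_ln_quadratic_ratio].
Qed.

End cauchy_convolution.

(** * From densities to the stability of the Cauchy law *)

Section cauchy_stability.
Context {R : realType}.
Local Notation mu := (@lebesgue_measure R).
Local Notation kappa := (@cauchy_prob R).

Lemma cauchy_pdf_density : @cauchy_pdf R = cauchy_density 1 0.
Proof.
by apply/funext => x; rewrite /cauchy_pdf /cauchy_density subr0 expr1n mul1r.
Qed.

Lemma cauchy_prob_itvy (z : R) :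
  kappa `[z, +oo[%classic = (2^-1 - pi^-1 * atan z)%:E.
Proof.
rewrite /cauchy_prob cauchy_pdf_density integral_cauchy_densityy //.
by rewrite subr0 divr1.
Qed.

Import HBNNSimple.

(** Linearity reduces the formula to the indicator of each level set, where it is the definition of
    [cauchy_prob]. *)
Let integral_cauchy_prob_nnsfun (f : {nnsfun R >-> R}) :
  (\int[kappa]_x (f x)%:E = \int[mu]_x ((f x)%:E * (cauchy_pdf x)%:E))%E.
Proof.
have mc : measurable_fun setT (EFin \o @cauchy_pdf R).
  by apply/measurable_EFinP; exact: measurable_cauchy_pdf.
have mind r : measurable_fun [set: R] (fun x : R => (r * \1_(f @^-1` [set r]) x)%:E).
  exact/measurable_EFinP/measurableT_comp.
under [LHS]eq_integral do rewrite fimfunE -fsumEFin//.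
rewrite [LHS]ge0_integral_fsum//; last first.
  by move=> n x _; rewrite EFinM nnfun_muleindic_ge0.
under [RHS]eq_integral.
  move=> x xD; rewrite fimfunE -fsumEFin// muleC ge0_mule_fsumr; last first.
    by move=> r; rewrite EFinM nnfun_muleindic_ge0.
  over.
rewrite [RHS]ge0_integral_fsum//; last 2 first.
  - by move=> r; apply: emeasurable_funM => //; exact: mind.
  - move=> n x _; rewrite EFinM mule_ge0//; last by rewrite nnfun_muleindic_ge0.
    by rewrite lee_fin cauchy_pdf_ge0.
apply: eq_fsbigr => r _.
under [RHS]eq_integral do rewrite EFinM muleCA.
have [r0|r0] := ltP r 0.
  rewrite preimage_nnfun0 // [LHS]integral0_eq ?[RHS]integral0_eq // => x _;
    by rewrite indicE in_set0 ?mulr0 ?mule0.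
under eq_integral do rewrite EFinM.
have mA : measurable (f @^-1` [set r]) by [].
have mind1 : measurable_fun [set: R] (fun x : R => (\1_(f @^-1` [set r]) x : R)%:E).
  by apply/measurable_EFinP; apply: measurable_indic.
rewrite !ge0_integralZl_EFin //.
- congr (_ * _)%E; rewrite integral_indic // setIT.
  transitivity (\int[mu]_(x in f @^-1` [set r]) (cauchy_pdf x)%:E)%E; first by [].
  rewrite [LHS]integral_mkcond; apply: eq_integral => x _; rewrite patchE indicE.
  by case: ifPn => _; rewrite ?mule1 ?mule0.
- by move=> x _; rewrite mule_ge0 // lee_fin cauchy_pdf_ge0.
- exact: emeasurable_funM mc mind1.
Qed.

(** Monotone approximation by simple functions, on both sides, reduces this to
    [integral_cauchy_prob_nnsfun]. *)
Lemma integral_cauchy_prob (g : R -> \bar R) : measurable_fun setT g ->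
  (forall x, (0 <= g x)%E) ->
  (\int[kappa]_x g x = \int[mu]_x (g x * (cauchy_pdf x)%:E))%E.
Proof.
move=> mg g0.
have mc : measurable_fun setT (EFin \o @cauchy_pdf R).
  by apply/measurable_EFinP; exact: measurable_cauchy_pdf.
pose g_ := nnsfun_approx measurableT mg.
have mg_ n : measurable_fun [set: R] (fun x => (g_ n x)%:E).
  exact/measurable_EFinP/measurable_funTS.
have nd_ n m x : (n <= m)%N -> g_ n x <= g_ m x.
  by move=> nm; move: x; apply/lefP/nd_nnsfun_approx.
transitivity (lim (\int[kappa]_x (g_ n x)%:E @[n --> \oo])%E).
  rewrite -monotone_convergence//=.
  - apply: eq_integral => ? /[!inE] xD; apply/esym/cvg_lim => //=.
    exact: cvg_nnsfun_approx.
  - by move=> n ? _; rewrite lee_fin.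
  - by move=> ? _ ? ? mn; rewrite lee_fin; exact: nd_.
under eq_fun do rewrite integral_cauchy_prob_nnsfun.
rewrite -monotone_convergence//=.
- apply: eq_integral => x _; apply/cvg_lim => //.
  apply: cvgeZr => //.
  exact: cvg_nnsfun_approx.
- by move=> n; apply: emeasurable_funM => //; exact: mg_.
- by move=> n ? _; rewrite mule_ge0 // lee_fin ?cauchy_pdf_ge0.
- move=> ? _ ? ? mn; apply: lee_wpmul2r; first by rewrite lee_fin cauchy_pdf_ge0.
  by rewrite lee_fin; exact: nd_.
Qed.

Lemma cauchy_densityC (c u x : R) : cauchy_density c u x = cauchy_density c x u.
Proof. by rewrite /cauchy_density -opprB sqrrN. Qed.

(** In the variable [u = s * x + c * y] the inner tail is the integral of a density over [[z, +oo[].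
    Tonelli then lets the integral in [x] be taken first, where the convolution formula evaluates
    it. *)
Lemma cauchy_prob_halfplane (s c z : R) : 0 < s -> 0 < c ->
  (\int[kappa]_x kappa [set y | (z <= s * x + c * y)%R] =
   kappa [set x | (z <= (s + c) * x)%R])%E.
Proof.
move=> s0 c0; have sc0 : 0 < s + c by rewrite addr_gt0.
pose D := `[z, +oo[%classic.
pose h (p : R * measurableTypeR R) : \bar R :=
  (cauchy_density c p.2 (s * p.1) * \1_D p.2)%:E.
have h0 p : (0 <= h p)%E by rewrite lee_fin mulr_ge0 ?cauchy_density_ge0.
have mD : measurable D by exact: measurable_itv.
have mh : measurable_fun setT h.
  apply/measurable_EFinP; apply: measurable_funM; last first.
    by apply: (measurableT_comp (measurable_indic mD)); exact: measurable_snd.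
  rewrite (_ : (fun p => _) = cauchy_density c 0 \o
      (fun p : R * measurableTypeR R => s * p.1 - p.2)).
    apply: measurableT_comp.
      by apply: continuous_measurable_fun; exact: continuous_cauchy_density.
    apply: measurable_funB; last exact: measurable_snd.
    by apply: measurable_funM => //; exact: measurable_fst.
  by apply/funext => p; rewrite /cauchy_density /= subr0.
(* The rescaling goes through the closed arctangent form of both tails, at the common point
   [(z - s * x) / c]. *)
have inner x : (kappa [set y | (z <= s * x + c * y)%R] = \int[mu]_u h (x, u))%E.
  transitivity (\int[mu]_(u in D) (cauchy_density c (s * x) u)%:E)%E.
    rewrite integral_cauchy_densityy // -cauchy_prob_itvy; congr (kappa _).
    apply/seteqP; split => y /=;
      by rewrite in_itv /= andbT ler_pdivrMr // lerBlDl [y * c]mulrC.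
  rewrite [LHS]integral_mkcond; apply: eq_integral => u _.
  rewrite patchE /h /= indicE cauchy_densityC.
  by case: ifPn => _; rewrite ?mulr1 ?mulr0.
have outer u : u != 0 -> (\int[kappa]_x h (x, u) = (cauchy_density (s + c) 0 u * \1_D u)%:E)%E.
  move=> u0; rewrite /h /=.
  under eq_integral do rewrite mulrC EFinM.
  rewrite ge0_integralZl_EFin //; last first.
  - apply/measurable_EFinP; apply: continuous_measurable_fun.
    exact: continuous_cauchy_density_affine.
  - by move=> x _; rewrite lee_fin cauchy_density_ge0.
  rewrite integral_cauchy_prob; last first.
  - by move=> x; rewrite lee_fin cauchy_density_ge0.
  - apply/measurable_EFinP; apply: continuous_measurable_fun.
    exact: continuous_cauchy_density_affine.
  under eq_integral do rewrite -EFinM.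
  by rewrite cauchy_density_convolution // mulrC.
under eq_integral do rewrite inner.
rewrite fubini_tonelli //.
transitivity (\int[mu]_(u in D) (cauchy_density (s + c) 0 u)%:E)%E; last first.
  rewrite integral_cauchy_densityy // -cauchy_prob_itvy; congr (kappa _).
  by apply/seteqP; split => y /=; rewrite in_itv /= andbT ler_pdivrMr // subr0 [y * _]mulrC.
rewrite [RHS]integral_mkcond.
have -> : ((fun u => (cauchy_density (s + c) 0 u)%:E) \_ D =
    fun u => (cauchy_density (s + c) 0 u * \1_D u)%:E)%E.
  apply/funext => u; rewrite patchE indicE.
  by case: ifPn => _; rewrite ?mulr1 ?mulr0.
apply: ge0_ae_eq_integral => //.
- exact: measurable_fun_fubini_tonelli_G.
- apply/measurable_EFinP; apply: measurable_funM; last exact: measurable_indic.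
  by apply: continuous_measurable_fun; exact: continuous_cauchy_density.
- by move=> u _; apply: integral_ge0.
- by move=> u _; rewrite lee_fin mulr_ge0 ?cauchy_density_ge0.
(* The convolution formula leaves out [u = 0], a Lebesgue-null set. *)
exists [set 0]; split => //; first exact: lebesgue_measure_set1.
move=> u /=; apply: contra_notP => /eqP u0 _; exact: outer.
Qed.

(** Both sides are finite measures in [B], images of [kappa \x kappa] and of [kappa]. By
    [cauchy_prob_halfplane] they agree on the rays [[z, +oo[], which are stable under intersection
    and generate the Borel sets. *)
Lemma cauchy_pair_stable (s c : R) (B : set R) : 0 < s -> 0 < c -> measurable B ->
  ((kappa \x kappa) [set p | B (s * p.1 + c * p.2)%R] =
   kappa [set x | B ((s + c) * x)%R])%E.
Proof.
move=> s0 c0 mB.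
have mf : measurable_fun [set: R * R] (fun p : R * R => s * p.1 + c * p.2).
  by apply: measurable_funD; apply: measurable_funM.
have mg : measurable_fun [set: R] (fun x : R => (s + c) * x).
  exact: measurable_funM.
pose m1 : {measure set R -> \bar R} :=
  pushforward (kappa \x kappa)%E (fun p : R * R => s * p.1 + c * p.2).
pose m2 : {measure set R -> \bar R} := pushforward kappa (fun x : R => (s + c) * x).
have key : m1 mf B = m2 mg B; last exact: key.
apply: (measure_unique (@RGenCInfty.G R) (fun n => `[- n%:R, +oo[%classic)).
- exact: RGenCInfty.measurableE.
- move=> _ _ [x ->] [y ->]; exists (Num.max x y).
  by apply/seteqP; split => t /=; rewrite !in_itv /= !andbT ge_max;
    [move=> [-> ->]|move=> /andP[]].
- by move=> n; exists (- n%:R).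
- apply/seteqP; split => // x _.
  exists (Num.bound `|x|) => //=; rewrite in_itv /= andbT lerNl.
  by apply: (le_trans (ler_norm _)); rewrite normrN ltW // archi_boundP.
- move=> _ [z ->].
  transitivity (kappa [set x | (z <= (s + c) * x)%R]); last first.
    congr (kappa _).
    by apply/seteqP; split => y; rewrite /= in_itv /= andbT.
  rewrite -cauchy_prob_halfplane //; apply: eq_integral => x _.
  congr (kappa _); apply/seteqP.
  by split => y; rewrite /xsection /= inE /= in_itv /= andbT.
- move=> n; apply: (@le_lt_trans _ _ 1%E); last exact: ltry.
  apply: (@probability_le1 _ _ _ (kappa \x kappa)%E).
  rewrite -[X in measurable X]setTI; apply: mf => //.
- exact: mB.
Qed.

End cauchy_stability.

(** * Weighted sums of Cauchy variables on a conditioning event *)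

Section cauchy_weighted_sum.
Context d (T : measurableType d) {R : realType} (P : probability T R).
Local Notation kappa := (@cauchy_prob R).

(** If [P C] is 0, both sides vanish. Otherwise the restriction of [P] to [C], pushed forward by the
    pair [(U, V)] and divided by [P C], agrees with [kappa \x kappa] on rectangles, hence
    everywhere, and [cauchy_pair_stable] applies. *)
Lemma cauchy_sum_pair (C : set T) (U V : T -> R) (s c : R) :
  measurable C -> measurable_fun setT U -> measurable_fun setT V ->
  0 < s -> 0 < c ->
  (forall A B, measurable A -> measurable B ->
    P (C `&` (U @^-1` A `&` V @^-1` B)) = P C * (kappa A * kappa B))%E ->
  forall B, measurable B ->
    (P (C `&` [set w | B (s * U w + c * V w)%R]) =
     P C * kappa [set x | B ((s + c) * x)%R])%E.
Proof.
move=> mC mU mV s0 c0 indep B mB.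
have mf : measurable_fun [set: R * R] (fun p : R * R => s * p.1 + c * p.2).
  by apply: measurable_funD; apply: measurable_funM.
have mE : measurable [set w | B (s * U w + c * V w)%R].
  have mg : measurable_fun setT (fun w => s * U w + c * V w).
    by apply: measurable_funD; apply: measurable_funM.
  by rewrite -[X in measurable X]setTI; exact: mg.
have [PC0|PC0] := eqVneq (P C) 0%E.
  rewrite PC0 mul0e; apply/eqP; rewrite eq_le measure_ge0 andbT -PC0.
  by apply: le_measure; rewrite ?inE //; exact: measurableI.
have PCfin : P C \is a fin_num by exact: fin_num_measure.
pose r : R := fine (P C).
have PCr : P C = r%:E by rewrite fineK.
have r0 : 0 < r by rewrite lt_neqAle -!lee_fin -PCr measure_ge0 andbT -eqe -PCr eq_sym.
have mUV : measurable_fun setT (fun w => (U w, V w)) by exact: measurable_fun_pair.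
have r1 : 0 <= r^-1 by rewrite invr_ge0 ltW.
pose f w := (U w, V w).
pose nu0 : {measure set (R * R) -> \bar R} := pushforward (mrestr P mC) f.
pose nu : {measure set (R * R) -> \bar R} := mscale (NngNum r1) (nu0 mUV).
have nuE A : nu A = (r^-1%:E * P (f @^-1` A `&` C))%E by [].
have nuM A D : measurable A -> measurable D -> nu (A `*` D) = (kappa A * kappa D)%E.
  move=> mA mD; rewrite nuE setIC.
  rewrite (_ : f @^-1` _ = U @^-1` A `&` V @^-1` D) // indep // PCr muleA -EFinM.
  by rewrite mulVf ?gt_eqF // mul1e.
have H := @product_measure_unique _ _ _ _ R kappa kappa nu nuM
  [set p | B (s * p.1 + c * p.2)].
rewrite -cauchy_pair_stable // H; last by rewrite -[X in measurable X]setTI; exact: mf.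
rewrite nuE PCr muleA -EFinM divff ?gt_eqF // mul1e; congr (P _).
exact: setIC.
Qed.

(** By induction, the sum of all terms but the last, divided by its total coefficient, is standard
    Cauchy given [C]; [cauchy_sum_pair] adds the last term. The event [C] varies in the induction so
    that it can absorb a condition on the last variable. *)
Lemma cauchy_weighted_sum (X : nat -> {RV P >-> R}) (c : nat -> R) (m : nat) :
  (forall i, 0 < c i) -> forall C : set T, measurable C ->
  (forall B : nat -> set R, (forall i, measurable (B i)) ->
    P (C `&` \big[setI/setT]_(i < m.+1) (X i @^-1` B i)) =
    P C * \prod_(i < m.+1) kappa (B i))%E ->
  forall B, measurable B ->
    (P (C `&` [set w | B (\sum_(i < m.+1) c i * X i w)%R]) =
     P C * kappa [set x | B ((\sum_(i < m.+1) c i) * x)%R])%E.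
Proof.
move=> c0; have mX i A : measurable A -> measurable (X i @^-1` A).
  by move=> mA; rewrite -[X in measurable X]setTI; exact: measurable_funP.
elim: m => [|m IH] C mC indep B mB.
  have := indep (fun i => [set x | B (c i * x)]).
  rewrite !big_ord1; move=> /= <-.
    congr (P (_ `&` _)); apply/seteqP; split => w /=; by rewrite big_ord1.
  move=> i; rewrite -[X in measurable X]setTI.
  have mc : measurable_fun [set: R] (fun x : R => c i * x) by apply: measurable_funM.
  exact: mc.
set s := \sum_(i < m.+1) c i.
have s0 : 0 < s by rewrite /s big_ord_recl ltr_pwDl // sumr_ge0 // => i _; exact: ltW.
pose S w := \sum_(i < m.+1) c i * X i w.
have mS : measurable_fun setT S by apply: measurable_sum => i; apply: measurable_funM.
have split_sum w : \sum_(i < m.+2) c i * X i w = s * (s^-1 * S w) + c m.+1 * X m.+1 w.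
  by rewrite big_ord_recr /= mulrA divff ?gt_eqF // mul1r.
have -> : [set w | B (\sum_(i < m.+2) c i * X i w)] =
    [set w | B (s * (s^-1 * S w) + c m.+1 * X m.+1 w)].
  by apply/seteqP; split => w /=; rewrite split_sum.
rewrite big_ord_recr /= -/s.
apply: cauchy_sum_pair => //; first by apply: measurable_funM.
move=> A D mA mD.
(* The induction hypothesis on [C'] gives the joint law of the normalised partial sum and of
   [X m.+1], hence their independence given [C]. *)
pose C' := C `&` X m.+1 @^-1` D.
have mC' : measurable C' by apply: measurableI => //; exact: mX.
have extend (B' : nat -> set R) : (forall i, measurable (B' i)) ->
    (P (C' `&` \big[setI/setT]_(i < m.+1) (X i @^-1` B' i)) =
     P C * kappa D * \prod_(i < m.+1) kappa (B' i))%E.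
  (* [B'] is completed by [D] at the last index, to match the hypothesis on [m.+2] variables. *)
  move=> mB'; pose B2 i := if i == m.+1 then D else B' i.
  have := indep B2 _; rewrite big_ord_recr [X in _ = (_ * X)%E]big_ord_recr /= /B2 eqxx.
  have lt i : ((i : 'I_m.+1) == m.+1 :> nat) = false by rewrite ltn_eqF.
  under eq_bigr do rewrite lt.
  under [X in _ = (_ * (X * _))%E]eq_bigr do rewrite lt.
  rewrite -/C' => E; rewrite /C' -setIA [X in _ `&` X]setIC E.
    by rewrite -muleA; congr (_ * _)%E; rewrite muleC.
  by move=> i; case: ifP.
have PC' : P C' = (P C * kappa D)%E.
  have := extend (fun=> setT) (fun=> measurableT).
  rewrite (_ : \big[setI/setT]_(i < m.+1) _ = setT) ?big1 //.
    by rewrite setIT mule1.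
  by move=> i _; exact: probability_setT.
have mscale_pre (k : R) A' : measurable A' -> measurable [set x : R | A' (k * x)].
  move=> mA'; rewrite -[X in measurable X]setTI.
  have mk : measurable_fun [set: R] (fun x : R => k * x) by apply: measurable_funM.
  exact: mk.
have := IH C' mC' _ [set x | A (s^-1 * x)] (mscale_pre _ _ mA).
rewrite PC' => /(_ extend) E.
rewrite (_ : C `&` _ = C' `&` [set w | A (s^-1 * S w)]); last first.
  by rewrite /C' -setIA; congr (_ `&` _); exact: setIC.
rewrite E -muleA [(kappa D * _)%E]muleC; congr (_ * (kappa _ * _))%E.
by apply/seteqP; split => x /=; rewrite -/s mulrA mulVf ?gt_eqF // mul1r.
Qed.

End cauchy_weighted_sum.

(** * A law with lacunary atoms *)

Section lacunary_law.
Context {R : realType} (m : nat).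

(** The base [q] is encoded as [m.*2.+2]: it is even with half [m.+1], so the sample size
    [q ^ (k + 1) / 2] is the integer [m.+1 * q ^ k]. *)
Definition ratio : R := (m.*2.+2%:R)^-1.

Definition level (k : nat) : R := m.*2.+2%:R ^+ (k * k).

Lemma ratio_gt0 : 0 < ratio. Proof. by rewrite invr_gt0 ltr0n. Qed.

Lemma ratio_lt1 : ratio < 1.
Proof. by rewrite invf_lt1 ?ltr0n // ltr1n. Qed.

Lemma level_gt0 k : 0 < level k. Proof. by rewrite exprn_gt0 // ltr0n. Qed.

Lemma level_mono : {mono level : i j / (i <= j)%N >-> i <= j}.
Proof.
have b1 : 1 < m.*2.+2%:R :> R by rewrite ltr1n.
by move=> i j; rewrite /level ler_eXn2l // leq_sqr -?mulnn.
Qed.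

(** With [q = m.*2.+2] and sample size [n = m.+1 * q ^ k], one value at level [k.+1] outweighs [n]
    values at level [k]: the quotient of the two levels is [q ^ (2 * k + 1)]. *)
Lemma level_growth k : m.+1%:R * m.*2.+2%:R ^+ k * level k <= level k.+1.
Proof.
have b1 : 1 <= m.*2.+2%:R :> R by rewrite ler1n.
have -> : level k.+1 = m.*2.+2%:R ^+ k.+1 * m.*2.+2%:R ^+ k * level k.
  by rewrite /level -!exprD; congr (_ ^+ _); lia.
rewrite ler_wpM2r ?(ltW (level_gt0 _)) // ler_wpM2r ?exprn_ge0 ?ler0n //.
rewrite exprS -[leLHS]mulr1 ler_pM ?ler0n ?ler_nat ?exprn_ege1 //.
by rewrite ltnW // ltnS -addnn; lia.
Qed.

(** The partial sums telescope, leaving mass [ratio ^+ k] from [level k] on. *)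
Definition geometric_mass (k : nat) : R := ratio ^+ k * (1 - ratio).

Lemma geometric_mass_ge0 k : 0 <= geometric_mass k.
Proof.
by rewrite mulr_ge0 ?exprn_ge0 ?subr_ge0 ?ltW ?ratio_gt0 ?ratio_lt1.
Qed.

Lemma sum_geometric_mass k : \sum_(0 <= i < k) geometric_mass i = 1 - ratio ^+ k.
Proof.
elim: k => [|k IH]; first by rewrite big_nil expr0 subrr.
by rewrite big_nat_recr //= IH /geometric_mass exprS; ring.
Qed.

Definition lacunary_law : set R -> \bar R :=
  mseries (fun k => mscale (NngNum (geometric_mass_ge0 k)) \d_(level k)) 0.

HB.instance Definition _ := Measure.on lacunary_law.

Lemma lacunary_lawE B :
  lacunary_law B = (\sum_(0 <= k <oo) (geometric_mass k * \1_B (level k))%:E)%E.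
Proof. by apply: eq_eseriesr => k _; rewrite /mscale /= EFinM. Qed.

Lemma lacunary_law_below B K : (forall k, B (level k) <-> (k < K)%N) ->
  lacunary_law B = (1 - ratio ^+ K)%:E.
Proof.
move=> BK; rewrite lacunary_lawE (nneseries_split _ K); last first.
  by move=> k _; rewrite lee_fin mulr_ge0 ?geometric_mass_ge0.
rewrite add0n [X in (_ + X)%E]eseries0; last first.
  move=> k Kk _; rewrite indicE memNset ?mulr0 // => /BK.
  by rewrite ltnNge Kk.
rewrite adde0 sumEFin -sum_geometric_mass; congr EFin.
apply: eq_big_nat => k /andP[_ kK].
by rewrite indicE mem_set ?mulr1 //; apply/BK.
Qed.

Lemma lacunary_law_full B : (forall k, B (level k)) -> lacunary_law B = 1%E.
Proof.
move=> BT; rewrite lacunary_lawE.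
under eq_eseriesr do rewrite indicE mem_set // mulr1.
apply/cvg_lim => //.
rewrite (_ : (fun n => _) = (fun n => (1 - ratio ^+ n)%:E)); last first.
  by apply/funext => n; rewrite sumEFin sum_geometric_mass.
apply: cvg_EFin; first exact: nearW.
rewrite -[X in _ --> X]subr0; apply: cvgB; first exact: cvg_cst.
by apply: cvg_expr; rewrite gtr0_norm ?ratio_gt0 ?ratio_lt1.
Qed.

Let lacunary_lawT : lacunary_law setT = 1%E.
Proof. exact: lacunary_law_full. Qed.

HB.instance Definition _ :=
  Measure_isProbability.Build _ _ _ lacunary_law lacunary_lawT.

End lacunary_law.

(** * Oscillation of the largest weight *)

Section unmeasurable_expectation_bounds.
Context d (T : measurableType d) {R : realType} (P : probability T R).

(* No measurability is assumed: a nonnegative integral is a supremum over the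
   simple functions lying below the integrand. *)
Lemma ge0_expectation_le (f g : T -> R) :
  (forall w, 0 <= f w) -> (forall w, f w <= g w) -> ('E_P[f] <= 'E_P[g])%E.
Proof.
move=> f0 fg; rewrite unlock.
rewrite !ge0_integralTE; last 2 first.
- by move=> w; rewrite lee_fin (le_trans (f0 w)).
- by move=> w; rewrite lee_fin.
apply: le_ereal_sup => _ [h hf <-]; exists h => // w.
by rewrite (le_trans (hf w)) // lee_fin.
Qed.

(** Markov's inequality, by comparing [f] with [c * \1_E], which lies below it everywhere. *)
Lemma expectation_ge_event (f : T -> R) (E : set T) (c : R) :
  measurable E -> 0 <= c -> (forall w, 0 <= f w) ->
  (forall w, E w -> c <= f w) -> (c%:E * P E <= 'E_P[f])%E.
Proof.
move=> mE c0 f0 cf.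
have -> : (c%:E * P E = 'E_P[fun w => (c * \1_E w)%R])%E.
  rewrite unlock; under eq_integral do rewrite EFinM.
  rewrite ge0_integralZl_EFin //; first by rewrite integral_indic // setIT.
  by apply/measurable_EFinP; apply: measurable_indic.
apply: ge0_expectation_le => w; first by rewrite mulr_ge0.
rewrite indicE; case: (boolP (w \in E)) => [|_]; last by rewrite mulr0.
by rewrite inE mulr1; exact: cf.
Qed.

(** The function [c + \1_E] lies above [f]: on [E] because [f <= 1], off [E] because [f <= c]. *)
Lemma expectation_le_event (f : T -> R) (E : set T) (c : R) :
  measurable E -> 0 <= c -> (forall w, 0 <= f w <= 1) ->
  (forall w, ~ E w -> f w <= c) -> ('E_P[f] <= c%:E + P E)%E.
Proof.
move=> mE c0 f01 fc.
have -> : (c%:E + P E = 'E_P[fun w => (c + \1_E w)%R])%E.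
  rewrite unlock; under eq_integral do rewrite EFinD.
  rewrite ge0_integralD //; last first.
    by apply/measurable_EFinP; apply: measurable_indic.
  rewrite integral_indic // setIT integral_cst //.
  by rewrite [X in (_ * X)%E](probability_setT P) mule1.
apply: ge0_expectation_le => w; first by have /andP[] := f01 w.
rewrite indicE; case: (boolP (w \in E)) => [_|].
  by have /andP[_ /le_trans->//] := f01 w; rewrite lerDr.
by rewrite notin_setE addr0; exact: fc.
Qed.

End unmeasurable_expectation_bounds.

(** * The largest weight as a bounded continuous function on the simplex *)

Section top_mass.
Context {R : realType}.

Definition top_mass (q : ranked_simplex R) : R := val q 0%N.

Lemma top_mass_ge0 q : 0 <= top_mass q.
Proof. by have [_ + _] := set_mem (valP q); exact. Qed.

Lemma top_mass_le1 q : top_mass q <= 1.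
Proof.
have [_ q0 q1] := set_mem (valP q).
rewrite -lee_fin; apply: le_trans q1.
rewrite (nneseries_split _ 1%N); last by move=> k _; rewrite lee_fin.
rewrite add0n big_nat1 leeDl // nneseries_ge0 // => k _ _.
by rewrite lee_fin.
Qed.

Lemma continuous_top_mass : continuous top_mass.
Proof.
move=> q; apply: (@continuous_comp _ _ _ (val : ranked_simplex R -> {ptws nat -> R})
  (fun f : {ptws nat -> R} => f 0%N)).
  exact: initial_continuous.
exact: proj_continuous.
Qed.

Lemma top_mass_ge (y : nat -> R) n i : (forall i, (i < n)%N -> 0 < y i) ->
  (i < n)%N -> weight y n i <= top_mass (ranked_weights y n).
Proof.
move=> y0 i_n; rewrite /top_mass val_ranked_weights // /ranked_weight.
set s := [seq _ | _ <- _].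
have : weight y n i \in sort (fun a b : R => b <= a) s.
  by rewrite mem_sort; apply: map_f; rewrite mem_iota.
have : sorted (fun a b : R => b <= a) (sort (fun a b : R => b <= a) s).
  by apply: sort_sorted => a b; exact: le_total.
case: (sort _ s) => //= h t ht; rewrite inE => /predU1P[->//|].
have tr : transitive (fun a b : R => b <= a) by move=> b a e ba eb; exact: le_trans eb ba.
by have /allP H := order_path_min tr ht; exact: H.
Qed.

Lemma top_mass_le (y : nat -> R) n c : (forall i, (i < n)%N -> 0 < y i) ->
  0 <= c -> (forall i, (i < n)%N -> weight y n i <= c) ->
  top_mass (ranked_weights y n) <= c.
Proof.
move=> y0 c0 yc; rewrite /top_mass val_ranked_weights // /ranked_weight.
set s := [seq _ | _ <- _].
have : {in sort (fun a b : R => b <= a) s, forall x, x <= c}.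
  by move=> x; rewrite mem_sort => /mapP[i]; rewrite mem_iota => /yc ? ->.
by case: (sort _ s) => //= h t; apply; rewrite inE eqxx.
Qed.

End top_mass.

(** * Deterministic bounds on weights, and bounds on powers of [1 - t] *)

Section weight_bounds.
Context {R : realType}.
Implicit Types (y : nat -> R) (a : R).

(** The terms other than [y i] add up to at most [n%:R * a <= y i], so the total is at most twice
    [y i]. *)
Lemma weight_ge_half y (n i : nat) a : (i < n)%N -> 0 <= a ->
  (forall j, (j < n)%N -> 0 < y j) ->
  (forall j, (j < n)%N -> j != i -> y j <= a) ->
  n%:R * a <= y i -> 2^-1 <= weight y n i.
Proof.
move=> i_n a0 y0 ya nay; rewrite /weight.
have S0 : 0 < \sum_(k < n) y k.
  rewrite (bigD1 (Ordinal i_n)) //= ltr_pwDl ?y0 // sumr_ge0 // => k _.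
  exact/ltW/y0.
rewrite ler_pdivlMr // ler_pdivrMl // mulr_natl mulr2n.
rewrite (bigD1 (Ordinal i_n)) //= lerD2l (le_trans _ nay) //.
apply: (@le_trans _ _ (\sum_(k < n | k != Ordinal i_n) a)).
  by apply: ler_sum => k ki; apply: ya.
rewrite mulr_natl -[n in leRHS]card_ord -sumr_const.
by rewrite [leRHS](bigD1 (Ordinal i_n)) //= lerDr.
Qed.

(** The indices are cut into [N] consecutive blocks of length [b]. Each contributes at least its one
    entry that reaches [a], the others being nonnegative. *)
Lemma block_sum_ge y a (N b : nat) :
  (forall i, (i < N * b)%N -> 0 <= y i) ->
  (forall c, (c < N)%N -> exists2 j, (j < b)%N & a <= y (c * b + j)%N) ->
  N%:R * a <= \sum_(i < N * b) y i.
Proof.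
rewrite -(big_mkord xpredT y).
elim: N => [|N IH] y0 yb; first by rewrite mul0r mul0n big_nil.
rewrite mulSnr (@big_cat_nat _ _ _ (N * b)%N) ?leq_addr //=.
rewrite -natr1 mulrDl mul1r lerD //.
  apply: IH => [i iN|c cN]; first by apply: y0; rewrite mulSn ltn_addl.
  by apply: yb; rewrite ltnS ltnW.
have [j jb aj] := yb N (ltnSn N).
rewrite (le_trans aj) // (bigD1_seq (N * b + j)%N) ?iota_uniq //=; last first.
  by rewrite mem_index_iota leq_addr ltn_add2l.
rewrite lerDl big_seq_cond sumr_ge0 // => i; rewrite mem_index_iota => /andP[/andP[_ iN] _].
by apply: y0; rewrite mulSnr.
Qed.

Lemma weight_le_inv y a (n N i : nat) : (i < n)%N -> (0 < N)%N -> 0 < a ->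
  y i <= a -> N%:R * a <= \sum_(k < n) y k ->
  weight y n i <= N%:R^-1.
Proof.
move=> i_n N0 a0 yi NS; have N0' : 0 < N%:R :> R by rewrite ltr0n.
rewrite /weight ler_pdivrMr; last by rewrite (lt_le_trans _ NS) ?mulr_gt0.
by rewrite ler_pdivlMl // (le_trans _ NS) // ler_wpM2l // ltW.
Qed.

(** Bernoulli's inequality. *)
Lemma expr_onem_ge (t : R) n : 0 <= t <= 1 -> 1 - n%:R * t <= (1 - t) ^+ n.
Proof.
move=> /andP[t0 t1]; elim: n => [|n IH]; first by rewrite mul0r subr0 expr0.
rewrite exprS -natr1; apply: (@le_trans _ _ ((1 - t) * (1 - n%:R * t))); last first.
  by rewrite ler_wpM2l // subr_ge0.
have n0 : 0 <= n%:R * t * t by rewrite !mulr_ge0.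
by lra.
Qed.

(** A rational substitute for the bound by [exp (- n t)]. The product of the power and
    [1 + n%:R * t] stays at most 1, because [(1 - t) * (1 + (n + 1) * t) <= 1 + n * t]. *)
Lemma expr_onem_le (t : R) n : 0 <= t <= 1 -> (1 - t) ^+ n <= (1 + n%:R * t)^-1.
Proof.
move=> /andP[t0 t1]; have pos k : 0 < 1 + k%:R * t by rewrite ltr_pwDl // mulr_ge0.
rewrite -[leRHS]mul1r ler_pdivlMr //.
elim: n => [|n IH]; first by rewrite mul0r addr0 expr0 mulr1.
apply: le_trans IH; rewrite exprSr -mulrA ler_wpM2l ?exprn_ge0 ?subr_ge0 //.
have n0 : 0 <= n.+1%:R * t * t by rewrite !mulr_ge0.
by rewrite -natr1 in n0 *; lra.
Qed.

End weight_bounds.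

Section iid_rectangles.
Context d (T : measurableType d) {R : realType} (P : probability T R).
Context (G : probability R R) (Y : nat -> {RV P >-> R}).

Lemma measurable_rectangle (J : set nat) (B : nat -> set R) :
  (forall i, measurable (B i)) -> measurable (\bigcap_(i in J) (Y i @^-1` B i)).
Proof.
move=> mB; apply: bigcap_measurableType => k _.
by rewrite -[X in measurable X]setTI; exact: measurable_funP.
Qed.

Lemma iid_rectangle (J : seq nat) (B : nat -> set R) : iid Y G -> uniq J ->
  (forall i, measurable (B i)) ->
  P (\bigcap_(i in [set` J]) (Y i @^-1` B i)) = (\prod_(i <- J) G (B i))%E.
Proof.
move=> [indep law] uJ mB; rewrite indep //.
by apply: eq_bigr => i _; exact: law.
Qed.

End iid_rectangles.

(** * Two scales of sample sizes: one dominant value, or many comparable values *)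

Section oscillation.
Context d (T : measurableType d) {R : realType} (P : probability T R) (m : nat).
Context (Y : nat -> {RV P >-> R}).
Hypothesis iidY : iid Y (@lacunary_law R m).

Local Notation G := (@lacunary_law R m).
Local Notation level := (@level R m).
Local Notation ratio := (@ratio R m).
Local Notation top n := (fun w => top_mass (ranked_weights (fun i => Y i w) n)).

Let level_le i j : (level i <= level j) = (i <= j)%N.
Proof. exact: (@level_mono R m i j). Qed.

Let level_lt i j : (level i < level j) = (i < j)%N.
Proof. by rewrite ltNge level_le -ltnNge. Qed.

Lemma lacunary_law_lt k : G `]-oo, level k[%classic = (1 - ratio ^+ k)%:E.
Proof.
by apply: lacunary_law_below => i; rewrite /= in_itv /= level_lt.
Qed.

Lemma lacunary_law_itv k : G `]0, level k]%classic = (1 - ratio ^+ k.+1)%:E.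
Proof.
apply: lacunary_law_below => i.
by rewrite /= in_itv /= level_gt0 level_le ltnS.
Qed.

Lemma lacunary_law_ge k : G `[level k, +oo[%classic = (ratio ^+ k)%:E.
Proof.
rewrite -setCitvl probability_setC // [X in (_ - X)%E](lacunary_law_lt k).
by rewrite -EFinB; congr EFin; ring.
Qed.

Lemma top_mass_often_large k :
  ((8^-1)%:E <= 'E_P[top (m.+1 * m.*2.+2 ^ k)%N])%E.
Proof.
set n := (m.+1 * _)%N; set t := ratio ^+ k.+1.
have t01 : 0 <= t <= 1.
  by rewrite exprn_ge0 ?exprn_ile1 ?ltW ?ratio_gt0 ?ratio_lt1.
(* [t] is the mass from [level k.+1] on, so the mean number of such values in a sample of size [n]
   is one half. *)
have nt : n%:R * t = 2^-1.
  rewrite /n /t /ratio exprVn exprSr natrM natrX.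
  have -> : m.*2.+2%:R = 2 * m.+1%:R :> R by rewrite -natrM; congr (_%:R); lia.
  have m0 : m.+1%:R != 0 :> R by rewrite pnatr_eq0.
  have q0 : (2 * m.+1%:R) ^+ k != 0 :> R by rewrite expf_neq0 // mulf_neq0 ?pnatr_eq0.
  by field; rewrite q0 andbT addrC natr1.
have n0 : (0 < n)%N by rewrite muln_gt0 expn_gt0.
(* On [E i] only index [i] reaches [level k.+1], all the others lying in []0, level k]]. The lower
   end 0 keeps the sample positive, so that [ranked_weights] has its genuine value. *)
pose B (i j : nat) : set R := if j == i then `[level k.+1, +oo[%classic else `]0, level k]%classic.
have mB i j : measurable (B i j) by rewrite /B; case: ifP => _; exact: measurable_itv.
pose E i := \bigcap_(j in [set` iota 0 n]) (Y j @^-1` B i j).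
have mE i : measurable (E i) by exact: measurable_rectangle.
have PE i : (i < n)%N -> P (E i) = (t * (1 - t) ^+ n.-1)%:E.
  move=> i_n; rewrite (iid_rectangle _ _ _ _ _ _ _ iidY) ?iota_uniq //.
  rewrite (bigD1_seq i) ?iota_uniq ?mem_iota //= /B eqxx lacunary_law_ge EFinM.
  congr (_ * _)%E.
  transitivity (\prod_(j <- iota 0 n | j != i) (1 - t)%:E)%E.
    by apply: eq_bigr => j /negbTE ->; exact: lacunary_law_itv.
  rewrite prodEFin big_const_seq iter_mulr_1; congr ((_ ^+ _)%:E).
  have := count_predC (pred1 i) (iota 0 n); rewrite count_uniq_mem ?iota_uniq //.
  by rewrite mem_iota i_n size_iota; move=> e; rewrite -[in RHS]e.
have EY i w : (i < n)%N -> E i w -> [/\ level k.+1 <= Y i w,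
    forall j, (j < n)%N -> 0 < Y j w &
    forall j, (j < n)%N -> j != i -> Y j w <= level k].
  move=> i_n Ew; have H j : (j < n)%N -> B i j (Y j w).
    by move=> jn; apply: Ew; rewrite /= mem_iota.
  have Yi : level k.+1 <= Y i w.
    by have := H i i_n; rewrite /B eqxx /= in_itv /= andbT.
  have Yj j : (j < n)%N -> j != i -> 0 < Y j w <= level k.
    by move=> jn ji; have := H j jn; rewrite /B (negbTE ji) /= in_itv.
  split => // [j jn|j jn ji]; last by have /andP[] := Yj j jn ji.
  have [->|ji] := eqVneq j i; last by have /andP[] := Yj j jn ji.
  exact: lt_le_trans (level_gt0 _ _) Yi.
have tE : trivIset `I_n E.
  apply/trivIsetP => i j /= i_n j_n ij; apply/seteqP; split => // w [Ei Ej].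
  have [Yi _ _] := EY i w i_n Ei; have [_ _ Yi'] := EY j w j_n Ej.
  have := le_trans Yi (Yi' i i_n ij); by rewrite level_le ltnn.
have mUE : measurable (\big[setU/set0]_(i < n) E i) by apply: bigsetU_measurable.
apply: (@le_trans _ _ ((2^-1)%:E * P (\big[setU/set0]_(i < n) E i))%E).
  have -> : P (\big[setU/set0]_(i < n) E i) =
      (\sum_(i < n) (t * (1 - t) ^+ n.-1)%:E)%E.
    rewrite measure_semi_additive_ord_I //.
    by apply: eq_bigr => i _; exact: PE.
  rewrite sumEFin -EFinM lee_fin sumr_const card_ord -[_ *+ n]mulr_natl [n%:R * _]mulrA nt.
  (* The disjoint events have total probability [n * t * (1 - t) ^+ n.-1], at least
     [1/2 * (1 - (n - 1) * t) >= 1/4]. The weight bound one half then yields 1/8. *)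
  have := expr_onem_ge t n.-1 t01.
  have : n.-1%:R * t <= n%:R * t by rewrite ler_wpM2r ?ler_nat ?leq_pred; case/andP: t01.
  rewrite nt; set X := _ ^+ _; lra.
apply: expectation_ge_event => //; first by move=> w; exact: top_mass_ge0.
move=> w; rewrite -bigcup_mkord => -[i /= i_n Ew].
have [Yi Y0 Yj] := EY i w i_n Ew.
apply: le_trans (top_mass_ge _ _ _ Y0 i_n).
apply: (weight_ge_half _ _ _ (level k)) => //; first exact/ltW/level_gt0.
by apply: le_trans Yi; rewrite natrM natrX; exact: level_growth.
Qed.

Lemma top_mass_often_small (N k : nat) : (0 < N)%N ->
  ('E_P[top (N * (N ^ 2 * m.*2.+2 ^ k))%N] <=
    (N%:R^-1 + N%:R ^+ 3 * ratio + N%:R / (1 + N%:R ^+ 2))%:E)%E.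
Proof.
move=> N0; set b := (N ^ 2 * _)%N; set n := (N * b)%N; set t := ratio ^+ k.
have r01 : 0 <= ratio <= 1 by rewrite !ltW ?ratio_gt0 ?ratio_lt1.
have t01 : 0 <= t <= 1 by case/andP: r01 => r0 r1; rewrite exprn_ge0 ?exprn_ile1.
(* A block of length [b] contains on average [N ^ 2] values from [level k] on. *)
have bt : b%:R * t = N%:R ^+ 2.
  rewrite /b /t /ratio exprVn natrM !natrX mulfK // expf_neq0 // pnatr_eq0.
(* Avoiding [A i] bounds [Y i] by [level k] and also makes it positive. [D c] is the event that no
   value in block [c] reaches [level k]. *)
pose A i := Y i @^-1` ~` `]0, level k]%classic.
pose D c := \bigcap_(j in [set` iota (c * b) b]) (Y j @^-1` `]-oo, level k[%classic).
have mA i : measurable (A i).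
  rewrite -[X in measurable X]setTI; apply: measurable_funP => //.
  by apply: measurableC; exact: measurable_itv.
have mD c : measurable (D c) by apply: measurable_rectangle => i; exact: measurable_itv.
have PA i : P (A i) = (ratio ^+ k.+1)%:E.
  rewrite iidY.2; last by apply: measurableC; exact: measurable_itv.
  rewrite probability_setC; last exact: measurable_itv.
  by rewrite [X in (_ - X)%E](lacunary_law_itv k) -EFinB; congr EFin; ring.
have PD c : P (D c) = ((1 - t) ^+ b)%:E.
  rewrite (iid_rectangle _ _ _ _ _ _ _ iidY) ?iota_uniq //.
  transitivity (\prod_(j <- iota (c * b) b) (1 - t)%:E)%E.
    by apply: eq_bigr => j _; exact: lacunary_law_lt.
  by rewrite prodEFin big_const_seq iter_mulr_1 count_predT size_iota.
pose UA := \big[setU/set0]_(i < n) A i; pose UD := \big[setU/set0]_(c < N) D c.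
have mUA : measurable UA by apply: bigsetU_measurable.
have mUD : measurable UD by apply: bigsetU_measurable.
(* Union bound: [n * ratio ^+ k.+1] is [N * (b * t) * ratio], that is [N ^ 3 * ratio]. *)
have PUA : (P UA <= (N%:R ^+ 3 * ratio)%:E)%E.
  apply: (@le_trans _ _ (\sum_(i < n) P (A i))%E); first exact: Boole_inequality.
  under eq_bigr do rewrite PA.
  rewrite sumEFin sumr_const card_ord -[_ *+ n]mulr_natl lee_fin.
  rewrite /n natrM exprSr mulrA -(mulrA N%:R) -/t bt.
  by rewrite -exprS.
(* Union bound: [N * (1 - t) ^+ b] is at most [N / (1 + b * t)], and [b * t = N ^ 2]. *)
have PUD : (P UD <= (N%:R / (1 + N%:R ^+ 2))%:E)%E.
  apply: (@le_trans _ _ (\sum_(c < N) P (D c))%E); first exact: Boole_inequality.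
  under eq_bigr do rewrite PD.
  rewrite sumEFin sumr_const card_ord -[_ *+ N]mulr_natl lee_fin ler_wpM2l //.
  by rewrite -bt; exact: expr_onem_le.
have top01 w : 0 <= top n w <= 1 by rewrite top_mass_ge0 top_mass_le1.
(* Off the exceptional events every value is at most [level k] and the total is at least
   [N * level k], so every weight is at most [1/N]. *)
apply: (@le_trans _ _ ((N%:R^-1)%:E + P (UA `|` UD))%E).
  apply: expectation_le_event => //; first exact: measurableU.
  move=> w; rewrite /UA /UD -!bigcup_mkord => /not_orP[nA nD].
  have Yw i : (i < n)%N -> 0 < Y i w <= level k.
    move=> i_n; have : ~ A i w by move=> Aw; apply: nA; exists i.
    by rewrite /A /= => /contrapT; rewrite in_itv.
  apply: top_mass_le => [i /Yw/andP[]//||i i_n]; first by rewrite invr_ge0.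
  have /andP[_ Yi] := Yw i i_n.
  apply: (weight_le_inv _ _ _ _ _ i_n N0 (level_gt0 _ _) Yi).
  apply: (block_sum_ge (fun i => Y i w) _ N b) => [j /Yw/andP[/ltW]//|c cN].
  have : ~ D c w by move=> Dw; apply: nD; exists c.
  move=> /existsNP[j /not_implyP[/=]]; rewrite mem_iota => /andP[cj jc].
  rewrite in_itv /= => /negP; rewrite -leNgt => Yj.
  by exists (j - c * b)%N; rewrite ?subnKC //; lia.
rewrite -addrA EFinD leeD2l //.
apply: (@le_trans _ _ (P UA + P UD)%E); first exact: measureU2.
by rewrite EFinD leeD.
Qed.

End oscillation.

(** Under convergence, the means of the largest weight would tend to the same [l] along both
    sequences of sample sizes. The first forces [1/8 <= l], the second bounds [l] by a constant
    below [1/8]. *)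
Lemma lacunary_law_no_limit {R : realType} (m N : nat) d (T : measurableType d)
    (P : probability T R) (Y : nat -> {RV P >-> R}) :
  (32 <= N)%N -> (N ^ 4 <= m)%N -> iid Y (@lacunary_law R m) ->
  ~ exists mu : probability (borel (ranked_simplex R)) R,
      converges_in_distribution P
        (fun n w => ranked_weights (fun i => Y i w) n) mu.
Proof.
move=> N32 Nm iidY [mu cvgmu].
have := cvgmu top_mass continuous_top_mass.
have bt : bounded_fun (@top_mass R).
  exists 1; split => // M M1 q _ /=.
  by rewrite ger0_norm ?top_mass_ge0 // (le_trans (top_mass_le1 q)) // ltW.
move=> /(_ bt); set l := ('E_mu[_])%E => El.
have subcvg (u : nat -> nat) : (forall k, (k <= u k)%N) ->
    ('E_P[top_mass \o (fun w => ranked_weights (fun i => Y i w) (u n))] @[n --> \oo] --> l)%E.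
  move=> uk; apply: (@cvg_comp _ _ _ u) El.
  apply/cvgnyPge => A; near=> n; apply: leq_trans (uk n).
  by near: n; exists A.
have kq k : (k <= m.*2.+2 ^ k)%N by apply/ltnW/ltn_expl.
have N0 : (0 < N)%N by exact: leq_trans N32.
have l1 : ((8^-1)%:E <= l)%E.
  have C := subcvg (fun k => m.+1 * m.*2.+2 ^ k)%N
    (fun k => leq_trans (kq k) (leq_pmull _ (ltn0Sn m))).
  rewrite -(cvg_lim _ C) //; apply: lime_ge; first by apply/cvg_ex; exists l.
  by apply: nearW => k; exact: top_mass_often_large.
set e := N%:R^-1 + N%:R ^+ 3 * @ratio R m + N%:R / (1 + N%:R ^+ 2).
have l2 : (l <= e%:E)%E.
  have C := subcvg (fun k => N * (N ^ 2 * m.*2.+2 ^ k))%N.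
  have /C {}C : forall k, (k <= N * (N ^ 2 * m.*2.+2 ^ k))%N.
    by move=> k; rewrite mulnA (leq_trans (kq k)) // leq_pmull // muln_gt0 N0 expn_gt0 N0.
  rewrite -(cvg_lim _ C) //; apply: lime_le; first by apply/cvg_ex; exists l.
  by apply: nearW => k; exact: top_mass_often_small.
have := le_trans l1 l2; rewrite lee_fin.
apply/negP; rewrite -ltNge /e.
have Nr : 32 <= N%:R :> R by rewrite (ler_nat _ 32).
set x := N%:R in Nr *.
(* Each of the three terms of [e] is at most [1/N <= 1/32], and [3/32 < 1/8]. The second term uses
   [N ^ 4 <= m <= m.*2.+2]. *)
have h1 : x^-1 <= 32^-1 by rewrite lef_pV2 ?posrE //; lra.
have h2 : x ^+ 3 * @ratio R m <= x^-1.
  rewrite /ratio ler_pdivrMr ?ltr0n // ler_pdivlMl; last lra.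
  rewrite -exprS /x -natrX ler_nat (leq_trans Nm) //; lia.
have h3 : x / (1 + x ^+ 2) <= x^-1.
  rewrite ler_pdivrMr ?ler_pdivlMl; nra.
lra.
Unshelve. all: end_near. Qed.

(** * Conditioning on the weights *)

Section atomic_variables.
Context d (T : measurableType d) {R : realType} (P : probability T R).
Context (Y : nat -> {RV P >-> R}) (a : nat -> R).
Hypothesis a_inj : injective a.
Hypothesis Y_atomic : forall i, P (Y i @^-1` ~` range a) = 0%E.

Let measurable_atom i j : measurable (Y i @^-1` [set a j]).
Proof. by rewrite -[X in measurable X]setTI; exact: measurable_funP. Qed.

(** Up to a null event [Y i] lies in [range a], and injectivity of [a] makes the fibres over the
    atoms disjoint. *)
Lemma atomic_partition i (F : set T) : measurable F ->
  P F = (\sum_(0 <= j <oo) P (F `&` Y i @^-1` [set a j]))%E.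
Proof.
move=> mF.
have mr : measurable (Y i @^-1` range a).
  rewrite (_ : _ @^-1` _ = \bigcup_j (Y i @^-1` [set a j])).
    exact: bigcupT_measurable.
  by rewrite -preimage_bigcup; congr (_ @^-1` _);
    apply/seteqP; split => [_ [j _ <-]|_ [j _ ->]]; exists j.
rewrite (@measureDI _ _ _ P F (Y i @^-1` range a)) //.
rewrite [X in (X + _)%E](_ : _ = 0%E) ?add0e; last first.
  apply/eqP; rewrite eq_le measure_ge0 andbT -(Y_atomic i).
  apply: le_measure; rewrite ?inE //; [exact: measurableD|].
  by rewrite preimage_setC; exact: measurableC.
rewrite -measure_semi_bigcup //; last 2 first.
- apply/trivIsetP => j k _ _ jk; apply/seteqP; split => // w [[_ /= wj] [_ /=]].
  by rewrite wj => /a_inj/eqP; rewrite (negbTE jk).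
- by apply: bigcupT_measurable => j; exact: measurableI.
rewrite -setI_bigcupr -preimage_bigcup; congr (P (_ `&` _ @^-1` _)).
by apply/seteqP; split => [_ [j _ <-]|_ [j _ ->]]; exists j.
Qed.

(** Elementary conditioning: [q] is the conditional probability of [E], the same on every atom of
    the first [n] variables. The induction sums over the values of one variable at a time, starting
    from the last. *)
Lemma atomic_conditioning (n : nat) (E : set T) (q : \bar R) :
  measurable E -> (0 <= q)%E -> q \is a fin_num ->
  forall C : set T, measurable C ->
  (forall k : nat -> nat,
    P (E `&` (C `&` \big[setI/setT]_(i < n) (Y i @^-1` [set a (k i)]))) =
    q * P (C `&` \big[setI/setT]_(i < n) (Y i @^-1` [set a (k i)])))%E ->
  P (E `&` C) = (q * P C)%E.
Proof.
move=> mE q0 qfin; elim: n => [|n IH] C mC H.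
  by have := H id; rewrite big_ord0 setIT.
apply: IH => // k; set D := _ `&` \big[_/_]_(_ < _) _.
have mD : measurable D.
  by apply: measurableI => //; apply: bigsetI_measurable.
rewrite (atomic_partition n) ?(atomic_partition n D) //; last exact: measurableI.
rewrite -(fineK qfin) -nneseriesZl; last by move=> j _; exact: measure_ge0.
apply: eq_eseriesr => j _.
pose k' i := if i == n then j else k i.
have := H k'; rewrite big_ord_recr /= /k' eqxx.
have lt (i : 'I_n) : (i == n :> nat) = false by rewrite ltn_eqF.
under eq_bigr do rewrite lt.
by rewrite !setIA -/D fineK.
Qed.

End atomic_variables.

(** * Mixtures of Cauchy variables with random weights *)

Section random_weights.
Context d (T : measurableType d) {R : realType} (P : probability T R).

Lemma measurable_inv : measurable_fun [set: R] (fun x : R => x^-1).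
Proof.
rewrite (_ : setT = [set 0] `|` [set x | x != 0]); last first.
  by apply/seteqP; split => // x _; have [->|] := eqVneq x 0; [left|right].
apply/measurable_funU => //.
  by apply: open_measurable; exact: open_neq.
split; first exact: measurable_fun_set1.
apply: open_continuous_measurable_fun; first exact: open_neq.
by move=> x; rewrite inE /= => x0; exact: inv_continuous.
Qed.

Lemma measurable_weight (Y : nat -> {RV P >-> R}) n i :
  measurable_fun setT (fun w => weight (fun k => Y k w) n i).
Proof.
apply: measurable_funM => //.
apply: (measurableT_comp measurable_inv).
exact: measurable_sum.
Qed.

(** This brings rectangles in finitely many variables within reach of [independent_families]. *)
Lemma sigma_of_rectangle (X : nat -> {RV P >-> R}) n (B : nat -> set R) :
  (forall i, measurable (B i)) ->
  sigma_of X (\big[setI/setT]_(i < n) (X i @^-1` B i)).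
Proof.
move=> mB; rewrite /sigma_of; set S := \bigcup_i _.
apply: (@bigsetI_measurable _ (g_sigma_algebraType S)) => i _.
apply: sub_sigma_algebra; exists (i : nat) => //.
by exists (B i) => //; rewrite setTI.
Qed.

Lemma iid_rectangle_ord (X : nat -> {RV P >-> R}) (G : probability R R) n
    (B : nat -> set R) : iid X G -> (forall i, measurable (B i)) ->
  P (\big[setI/setT]_(i < n) (X i @^-1` B i)) = (\prod_(i < n) G (B i))%E.
Proof.
move=> iidX mB; rewrite -(bigcap_mkord n (fun i => X i @^-1` B i)).
rewrite -(big_mkord xpredT (fun i => G (B i))).
rewrite -(iid_rectangle _ _ _ _ _ _ _ iidX) ?iota_uniq //; last first.
congr (P _); rewrite (_ : [set` _] = `I_n) //.
by apply/seteqP; split => i; rewrite /= mem_index_iota.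
Qed.

Lemma cauchy_mixture (m n : nat) (X Y : nat -> {RV P >-> R}) :
  iid X cauchy_prob -> iid Y (@lacunary_law R m) -> independent_families X Y ->
  same_law P
    (fun w => \sum_(i < n.+1) weight (fun k => Y k w) n.+1 i * X i w) (X 0%N).
Proof.
move=> iidX iidY indep B mB.
pose S w := \sum_(i < n.+1) weight (fun k => Y k w) n.+1 i * X i w.
have mS : measurable_fun setT S.
  by apply: measurable_sum => i; apply: measurable_funM => //; exact: measurable_weight.
have mE : measurable (S @^-1` B) by rewrite -[X in measurable X]setTI; exact: mS.
rewrite iidX.2 // -/S.
have atomic i : P (Y i @^-1` ~` range (@level R m)) = 0%E.
  have mr : measurable (~` range (@level R m)).
    apply: measurableC; rewrite (_ : range _ = \bigcup_j [set level m j]).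
      by apply: bigcupT_measurable => j; exact: measurable_set1.
    by apply/seteqP; split => [_ [j _ <-]|_ [j _ ->]]; exists j.
  rewrite iidY.2 // probability_setC; last by rewrite -[range _]setCK; exact: measurableC.
  rewrite [X in (_ - X)%E](_ : _ = 1%E) ?subee //; apply: (@lacunary_law_full R m) => k.
  by exists k.
have inj : injective (@level R m).
  by move=> i j /eqP; rewrite eq_le !level_mono -eqn_leq => /eqP.
(* With [q = cauchy_prob B] and the sure event as conditioning set, it suffices that the mixture has
   the Cauchy law given each atom of the first [n.+1] variables [Y i]. *)
have := atomic_conditioning _ _ _ _ _ inj atomic n.+1 _ (cauchy_prob B) mE _ _ setT measurableT.
rewrite setIT probability_setT mule1; apply => //; [exact: fin_num_measure|move=> k].
pose C := \big[setI/setT]_(i < n.+1) (Y i @^-1` [set level m (k i)]).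
rewrite setTI -/C.
(* On the event [C] the random weights are the constants [c i], positive and of sum 1. *)
pose c i : R := weight (fun j => level m (k j)) n.+1 i.
have S0 : 0 < \sum_(j < n.+1) level m (k j) :> R.
  rewrite big_ord_recl ltr_pwDl ?level_gt0 // sumr_ge0 // => j _.
  exact/ltW/level_gt0.
have c0 i : 0 < c i by rewrite divr_gt0 // level_gt0.
have c1 : \sum_(i < n.+1) c i = 1 by rewrite -mulr_suml divff ?gt_eqF.
have mC : measurable C.
  apply: bigsetI_measurable => i _; rewrite -[X in measurable X]setTI.
  by apply: measurable_funP => //; exact: measurable_set1.
have YC w : C w -> forall j, (j < n.+1)%N -> Y j w = level m (k j).
  rewrite /C -(bigcap_mkord n.+1 (fun j => Y j @^-1` [set level m (k j)])).
  by move=> Cw j jn; exact: Cw.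
have SC w : C w -> S w = \sum_(i < n.+1) c i * X i w.
  move=> /YC Yk; apply: eq_bigr => i _; congr (_ * _).
  rewrite /c /weight Yk //; congr (_ / _).
  by apply: eq_bigr => j _; exact: Yk.
have -> : S @^-1` B `&` C = C `&` [set w | B (\sum_(i < n.+1) c i * X i w)].
  by rewrite setIC; apply/seteqP; split => w [Cw]; rewrite /= SC.
have W : P (C `&` [set w | B (\sum_(i < n.+1) c i * X i w)]) =
    (P C * cauchy_prob [set x | B ((\sum_(i < n.+1) c i) * x)%R])%E.
  (* The product formula on rectangles comes from the independence of the two families, then from
     that of the [X i]. *)
  apply: (cauchy_weighted_sum _ _ P X c n c0 C mC _ B mB) => B' mB'.
  rewrite setIC indep.
  - by rewrite (iid_rectangle_ord _ _ _ _ iidX) // muleC.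
  - exact: sigma_of_rectangle.
  - apply: (sigma_of_rectangle Y n.+1 (fun i => [set level m (k i)])) => i.
    exact: measurable_set1.
rewrite W muleC c1; congr (cauchy_prob _ * _)%E.
by apply/seteqP; split => x /=; rewrite mul1r.
Qed.

End random_weights.

Theorem proposition8p1 (R : realType) :
  exists G : probability R R,
    [/\ G `]0, +oo[%classic = 1%E,
        (forall (d : measure_display) (T : measurableType d)
            (P : probability T R) (Y : nat -> {RV P >-> R}),
          iid Y G ->
          ~ exists mu : probability (borel (ranked_simplex R)) R,
              converges_in_distribution P
                (fun n w => ranked_weights (fun i => Y i w) n) mu)
      & (forall (d : measure_display) (T : measurableType d)
            (P : probability T R) (X Y : nat -> {RV P >-> R}),
          iid X cauchy_prob -> iid Y G -> independent_families X Y ->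
          forall n : nat, (1 <= n)%N ->
            same_law P
              (fun w => \sum_(i < n) weight (fun k => Y k w) n i * X i w)
              (X 0%N))].

Proof.
(* [N] is kept abstract so that [N ^ 4] is never computed as a unary number. *)
have [N N32] : exists N, (32 <= N)%N by exists 32%N.
exists (@lacunary_law R (N ^ 4)); split.
- apply: lacunary_law_full => k.
  by rewrite /= in_itv /= level_gt0.
- by move=> d T P Y; exact: (lacunary_law_no_limit _ N).
- move=> d T P X Y iidX iidY indep [//|n] _.
  exact: cauchy_mixture iidX iidY indep.
Qed.
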